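(* Let $a,b$ be coprime positive integers with $a>b\geqslant 1$ and let $\beta=-a/b$. Every alphabet $\mathcal{A}$ of contiguous integers containing $0$ with $\#\mathcal{A}=a+b$ allows parallel addition in base $\beta$. Moreover, no alphabet of contiguous integers containing $0$ and at least one other element, with fewer than $a+b$ elements, allows parallel addition in base $\beta$.
   Context: For a complex number $\beta$ with $|\beta|>1$ and a finite set $\mathcal{A}\subset\mathbb{C}$ containing $0$, let $\mathrm{Fin}_{\mathcal{A}}(\beta)=\{\sum_{j\in I}x_j\beta^j : I\subset\mathbb{Z}\text{ finite},\ x_j\in\mathcal{A}\}$. For finite alphabets $\mathcal{A},\mathcal{B}$, a map $\varphi:\mathcal{A}^{\mathbb{Z}}\to\mathcal{B}^{\mathbb{Z}}$ is $p$-local if there are integers $r,t\geqslant 0$ with $p=r+t+1$ and a map $\Phi:\mathcal{A}^p\to\mathcal{B}$ such that for every $u=(u_j)$ and $v=\varphi(u)$ one has $v_j=\Phi(u_{j+t}\cdots u_j\cdots u_{j-r})$ for all $j\in\mathbb{Z}$. A digit set conversion in base $\beta$ from $\mathcal{A}$ to $\mathcal{B}$ (both containing $0$) is a map $\varphi:\mathcal{A}^{\mathbb{Z}}\to\mathcal{B}^{\mathbb{Z}}$ such that whenever $u$ has finitely many nonzero entries, $v=\varphi(u)$ has finitely many nonzero entries and $\sum_j v_j\beta^j=\sum_j u_j\beta^j$. An alphabet $\mathcal{A}$ allows parallel addition in base $\beta$ if there is a digit set conversion in base $\beta$ from $\mathcal{A}+\mathcal{A}=\{x+y:x,y\in\mathcal{A}\}$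 to $\mathcal{A}$ that is $p$-local for some $p$. *)

(* Defs.v *)
From HB Require Import structures.
From mathcomp Require Import all_boot all_order all_algebra.
From mathcomp Require Import finmap.
From mathcomp Require Import all_classical reals.
From mathcomp Require Import complex.

Set Implicit Arguments.
Unset Strict Implicit.
Unset Printing Implicit Defensive.

Import Order.TTheory GRing.Theory Num.Theory.
Local Open Scope classical_set_scope.
Local Open Scope fset_scope.
Local Open Scope ring_scope.

(* A bi-infinite word over the alphabet A : {fset R[i]} is a function
   int -> A, with A coerced to the type of its elements. *)

Definition finitely_supported (R : realType) (A : {fset R[i]})
    (u : int -> A) : Prop :=
  finite_set [set j : int | fsval (u j) != 0].

(* The sum is meaningful for finitely supported words only: a finitary sum
   with infinite support is 0 by convention. *)
Definition word_value (R : realType) (beta : R[i]) (A : {fset R[i]})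
    (u : int -> A) : R[i] :=
  \sum_(j \in [set: int]) fsval (u j) * beta ^ j.

(* Entry i of the window at position j is u_(j + t - i), so that the tuple
   reads u_(j+t) ... u_j ... u_(j-r) from left to right. *)
Definition p_local (R : realType) (A B : {fset R[i]}) (p : nat)
    (phi : (int -> A) -> (int -> B)) : Prop :=
  exists r t : nat, p = (r + t + 1)%N /\
  exists Phi : p.-tuple A -> B,
  forall (u : int -> A) (j : int),
    phi u j = Phi [tuple u (j + t%:Z - (i : nat)%:Z) | i < p].

Definition digit_set_conversion (R : realType) (beta : R[i])
    (A B : {fset R[i]}) (phi : (int -> A) -> (int -> B)) : Prop :=
  forall u : int -> A, finitely_supported u ->
    finitely_supported (phi u) /\
    word_value beta (phi u) = word_value beta u.

Definition sumset (R : realType) (A B : {fset R[i]}) : {fset R[i]} :=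
  [fset x + y | x in A, y in B].

Definition allows_parallel_addition (R : realType) (beta : R[i])
    (A : {fset R[i]}) : Prop :=
  exists (p : nat) (phi : (int -> sumset A A) -> (int -> A)),
    digit_set_conversion beta phi /\ p_local p phi.

Definition contiguous_integers (R : realType) (A : {fset R[i]}) : Prop :=
  exists m M : int, forall x : R[i],
    (x \in A) <-> (exists2 k : int, m <= k <= M & x = k%:~R).

(* Main.v *)
(* Since b beta + a = 0, subtracting a q_j + b q_(j-1) from the digit in
   position j, for any finitely supported integer word q, leaves the value
   unchanged.  For the alphabet {m, ..., M} with M = m + a + b - 1 and digits in
   {m-1, ..., M+1}, a carry q_j in {-1, 0, 1} can be chosen from q_(j-1) and the
   digits in positions j and j-1 so that the new digits lie in {m, ..., M}, the
   zero word carries nothing, and q_j depends on the last four digits only.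
   Iterating this step handles {2m, ..., 2M}.

   Conversely, a - (-b) = a + b makes beta equal to 1 modulo a + b, so a word of
   value 0 has digit sum divisible by a + b.  Let u_n be the word with digit x on
   {0, ..., n-1} and 0 elsewhere, with n at least the window length of a local
   conversion.  The image of u_(n+1) is the image of u_n with one digit y
   duplicated, whence x = y modulo a + b.  Applied to x = M + 1 or x = m - 1,
   this forces the alphabet to have at least a + b elements. *)
Require Import Defs.
From HB Require Import structures.
From mathcomp Require Import all_boot all_order all_algebra.
From mathcomp Require Import finmap.
From mathcomp Require Import all_classical reals.
From mathcomp Require Import complex.
From mathcomp Require Import zify ring.

Set Implicit Arguments.
Unset Strict Implicit.
Unset Printing Implicit Defensive.

Import Order.TTheory GRing.Theory Num.Theory.
Local Open Scope fset_scope.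
Local Open Scope ring_scope.

(** * Finitely supported families on the integers and their sums *)

Definition fin_supp (V : nmodType) (f : int -> V) : Prop :=
  finite_set [set j | f j != 0]%classic.

Lemma fsumTE (V : nmodType) (f : int -> V) (A : {fset int}) :
  (forall j, f j != 0 -> j \in A) ->
  \sum_(j \in [set: int]%classic) f j = \sum_(j <- A) f j.
Proof.
by move=> fA; apply: fsbigTE => j; apply: contraNeq => /fA.
Qed.

Lemma mem_fin_supp (V : nmodType) (f : int -> V) (ff : fin_supp f) j :
  (j \in fset_set [set j | f j != 0]%classic) = (f j != 0).
Proof. by rewrite in_fset_set //; apply/idP/idP => [/set_mem | /mem_set]. Qed.

Lemma fsumD (V : nmodType) (f g : int -> V) : fin_supp f -> fin_supp g ->
  \sum_(j \in [set: int]%classic) (f j + g j) =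
  \sum_(j \in [set: int]%classic) f j + \sum_(j \in [set: int]%classic) g j.
Proof.
move=> ff fg.
pose A := fset_set [set j | f j != 0]%classic
          `|` fset_set [set j | g j != 0]%classic.
have memA j : (j \in A) = (f j != 0) || (g j != 0).
  by rewrite in_fsetU !mem_fin_supp.
rewrite !(@fsumTE _ _ A) ?big_split // => j; rewrite memA.
- by move=> ->; rewrite orbT.
- by move=> ->.
- by have [->|] := eqVneq (f j) 0; rewrite ?add0r.
Qed.

Lemma fsum_shift (V : nmodType) (f : int -> V) (k : int) :
  \sum_(j \in [set: int]%classic) f (j + k) =
  \sum_(j \in [set: int]%classic) f j.
Proof.
rewrite [RHS](@reindex_fsbigT _ _ _ _ _ (fun j => j + k)) //.
by exists (fun j => j - k) => j /=; rewrite ?addrK ?subrK.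
Qed.

Lemma fin_supp_ball (V : nmodType) (f : int -> V) :
  fin_supp f <-> exists N : nat, forall j, f j != 0 -> `|j| <= N%:Z.
Proof.
split=> [ff | [N fN]].
  pose S := fset_set [set j | f j != 0]%classic.
  exists (\max_(j <- S) `|j|)%N => j fj.
  rewrite -abszE lez_nat; apply: (leq_bigmax_seq (F := absz)) => //.
  by rewrite mem_fin_supp.
apply: (sub_finite_set (B := (fun i : nat => i%:Z - N%:Z) @` `I_(N + N).+1)%classic).
  move=> j /= /fN jN; exists `|(j + N%:Z)%R|%N => /=; lia.
exact/finite_image/finite_II.
Qed.

Lemma fin_supp_sub (V W : nmodType) (f : int -> V) (g : int -> W) :
  (forall j, g j != 0 -> f j != 0) -> fin_supp f -> fin_supp g.
Proof. by move=> gf; apply: sub_finite_set => j /= /gf. Qed.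

Lemma fin_suppD (V : nmodType) (f g : int -> V) :
  fin_supp f -> fin_supp g -> fin_supp (fun j => f j + g j).
Proof.
move=> /fin_supp_ball[N fN] /fin_supp_ball[K gK].
apply/fin_supp_ball; exists (N + K)%N => j.
have [f0|/fN] := eqVneq (f j) 0; last by move=> *; lia.
by rewrite f0 add0r => /gK; lia.
Qed.

Lemma fin_supp_shift (V : nmodType) (f : int -> V) k :
  fin_supp f -> fin_supp (fun j => f (j + k)).
Proof.
move=> /fin_supp_ball[N fN]; apply/fin_supp_ball; exists (N + `|k|)%N => j /fN.
lia.
Qed.

(** * Values of integer words in base [beta] *)

Definition int_value (F : fieldType) (beta : F) (w : int -> int) : F :=
  \sum_(j \in [set: int]%classic) (w j)%:~R * beta ^ j.

Lemma fin_supp_monomial (F : fieldType) (beta : F) (w : int -> int) :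
  fin_supp w -> fin_supp (fun j => (w j)%:~R * beta ^ j).
Proof.
by apply: fin_supp_sub => j; apply: contra_neq => ->; rewrite mul0r.
Qed.

Lemma int_valueD (F : fieldType) (beta : F) (u v : int -> int) :
  fin_supp u -> fin_supp v ->
  int_value beta (fun j => u j + v j) = int_value beta u + int_value beta v.
Proof.
move=> fu fv; rewrite /int_value -fsumD; try exact: fin_supp_monomial.
by apply: eq_fsbigr => j _; rewrite intrD mulrDl.
Qed.

Lemma int_valueZ (F : fieldType) (beta : F) (c : int) (u : int -> int) :
  int_value beta (fun j => c * u j) = c%:~R * int_value beta u.
Proof.
by rewrite mulr_fsumr; apply: eq_fsbigr => j _; rewrite intrM mulrA.
Qed.

Lemma int_value_shift (F : fieldType) (beta : F) (u : int -> int) :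
  beta != 0 -> int_value beta (fun j => u (j - 1)) = beta * int_value beta u.
Proof.
move=> b0; rewrite mulr_fsumr -[RHS](fsum_shift _ (-1)).
by apply: eq_fsbigr => j _; rewrite expfzDr // exprN1 mulrCA [_ * (_ * _^-1)]mulrCA divff // mulr1.
Qed.

(** * Local shift-invariant maps on integer words *)

(** Comparing two words at two positions puts locality and commutation with shifts into one
    condition. *)
Definition sliding_block (F : (int -> int) -> int -> int) : Prop :=
  exists N : nat, forall u v j k,
    (forall i, `|i| <= N%:Z -> u (j + i) = v (k + i)) -> F u j = F v k.

Lemma sliding_block_comp F G :
  sliding_block F -> sliding_block G -> sliding_block (F \o G).
Proof.
move=> [N FN] [K GK]; exists (N + K)%N => u v j k uv /=.
apply: FN => i iN; apply: GK => l lK; rewrite -!addrA; apply: uv; lia.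
Qed.

Lemma sliding_block_op2 (op : int -> int -> int) F G :
  sliding_block F -> sliding_block G ->
  sliding_block (fun u j => op (F u j) (G u j)).
Proof.
move=> [N FN] [K GK]; exists (N + K)%N => u v j k uv.
by congr op; [apply: FN | apply: GK] => i ?; apply: uv; lia.
Qed.

Lemma sliding_block_shift (k : int) : sliding_block (fun u j => u (j + k)).
Proof. by exists `|k|%N => u v i j; apply; lia. Qed.

Lemma sliding_block_letter (f : int -> int) :
  sliding_block (fun u j => f (u j)).
Proof.
by exists 0 => u v i j uv; move: (uv 0); rewrite !addr0 => -> //.
Qed.

(** Far from the support of [u], the window looks like that of the zero word. *)
Lemma fin_supp_sliding_block F : sliding_block F ->
  (forall j, F (fun=> 0) j = 0) -> forall u, fin_supp u -> fin_supp (F u).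
Proof.
move=> [N FN] F0 u /fin_supp_ball[K uK]; apply/fin_supp_ball.
exists (N + K)%N => j; apply: contraNT => jNK; apply/eqP.
rewrite -(F0 j); apply: FN => i iN; apply/eqP.
by apply: contraNT jNK => /uK; lia.
Qed.


(** * The carry rule and one step of carrying *)

(* A digit of {m, ..., M} is Low if it cannot absorb an incoming carry 1 (which
   subtracts b), and High if it cannot absorb -1; Below and Above are m - 1 and
   M + 1. *)
Variant band := Below | Low | Mid | High | Above.

Definition band_of (b m M x : int) : band :=
  if x < m then Below else if x < m + b then Low
  else if x <= M - b then Mid else if x <= M then High else Above.

(* c' and c are the bands of the preceding and of the current digit, s is the
   incoming carry.  The only carries not forced or constant are those of Low and
   High digits at s = 0.  Low answers 0; High answers 1 unless it follows a High
   digit, which breaks the alternations 1, -1, 1, -1, ... along Low, High, Low,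
   High, ... that never forget their initial carry. *)
Definition carry (c' c : band) (s : int) : int :=
  match c with
  | Below => -1
  | Low => if s == 1 then -1 else 0
  | Mid => 0
  | High => if c' is High then (if s == -1 then 1 else 0)
            else (if s == 1 then 0 else 1)
  | Above => 1
  end.

Lemma carry_range c' c s : -1 <= carry c' c s <= 1.
Proof. by case: c => //=; [case: ifP | case: c'; case: ifP]. Qed.

(** [Below], [Mid] and [Above] fix their carry. [Low] emits only -1 or 0 and [High] only 0 or 1, so
    among pairs of these two only [High] then [Low] can still transmit the initial carry. Three
    consecutive bands always contain a different pair. *)
Lemma carry_reset c3 c2 c1 c0 s t :
  carry c1 c0 (carry c2 c1 (carry c3 c2 s)) =
  carry c1 c0 (carry c2 c1 (carry c3 c2 t)).
Proof.
case: c0 => //; case: c1 => //; case: c2 => //=;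
  by repeat case: eqP => //=; case: c3 => /=; repeat case: eqP.
Qed.

(** The extreme digits are tight: m - 1 with s = -1 becomes exactly M, and with s = 1 it reaches m
    only because b < a; M + 1 is symmetric. *)
Lemma carry_digit (a b m M x s : int) c' :
  0 < b < a -> M = m + a + b - 1 -> m - 1 <= x <= M + 1 -> -1 <= s <= 1 ->
  m <= x - a * carry c' (band_of b m M x) s - b * s <= M.
Proof.
move=> ab -> x1 s1.
have [->|[->|->]] : s = -1 \/ s = 0 \/ s = 1 by lia.
all: rewrite /band_of; case: (ltP x) => ? /=; first lia.
all: case: (ltP x) => ? /=; first lia.
all: case: (leP x) => ? /=; first lia.
all: case: (leP x) => ? /=; last lia.
all: case: c'; lia.
Qed.

(** The bound [b <= M] keeps 0 out of [High], which may answer a zero carry by 1. *)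
Lemma carry00 (b m M : int) c' : m <= 0 -> b <= M ->
  carry c' (band_of b m M 0) 0 = 0.
Proof.
move=> m0 bM; rewrite /band_of; case: (ltP 0 m) => [|_]; first lia.
by case: (ltP 0 (m + b)) => //= _; case: (leP 0 (M - b)) => //; lia.
Qed.

(** The carry recursion unrolled three steps from an arbitrary start, here 0, so that locality is
    immediate. *)
Definition carry_at (b m M : int) (u : int -> int) (j : int) : int :=
  let c i := band_of b m M (u (j - i)) in
  carry (c 1) (c 0) (carry (c 2) (c 1) (carry (c 3) (c 2) 0)).

(** The two sides differ only in the carry entering at position j - 2, which [carry_reset] makes
    immaterial. *)
Lemma carry_at_rec b m M u j :
  carry_at b m M u j =
  carry (band_of b m M (u (j - 1))) (band_of b m M (u j))
        (carry_at b m M u (j - 1)).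
Proof.
rewrite {1}/carry_at subr0 /carry_at -!addrA -!opprD /=.
rewrite (_ : (1 + 0 : int) = 1) // (_ : (1 + 1 : int) = 2) //.
by rewrite (_ : (1 + 2 : int) = 3) //; exact: carry_reset.
Qed.

Definition carry_step (a b m M : int) (u : int -> int) (j : int) : int :=
  u j + (- a * carry_at b m M u j + - b * carry_at b m M u (j - 1)).

Lemma carry_step_digit (a b m M : int) u :
  0 < b < a -> M = m + a + b - 1 -> (forall j, m - 1 <= u j <= M + 1) ->
  forall j, m <= carry_step a b m M u j <= M.
Proof.
move=> ab eM um j; rewrite /carry_step carry_at_rec.
have := carry_digit (band_of b m M (u (j - 1))) ab eM (um j)
  (carry_range _ _ _ : -1 <= carry_at b m M u (j - 1) <= 1).
by rewrite addrA !mulNr.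
Qed.

Lemma sliding_block_carry_at b m M : sliding_block (carry_at b m M).
Proof.
exists 3 => u v j k uv; rewrite /carry_at !subr0.
by rewrite !(uv (- _)) // -(addr0 j) uv // addr0.
Qed.

Lemma sliding_block_carry_step a b m M : sliding_block (carry_step a b m M).
Proof.
apply: (sliding_block_op2 _ (sliding_block_letter id)).
apply: (sliding_block_op2 (fun x y => - a * x + - b * y)).
  exact: sliding_block_carry_at.
exact: (sliding_block_comp (sliding_block_shift (-1))
                           (sliding_block_carry_at b m M)).
Qed.

Lemma carry_at0 b m M j : m <= 0 -> b <= M -> carry_at b m M (fun=> 0) j = 0.
Proof. by move=> m0 bM; rewrite /carry_at !carry00. Qed.

Lemma int_value_carry_step (F : fieldType) (beta : F) a b m M u :
  beta != 0 -> a%:~R + b%:~R * beta = 0 -> m <= 0 -> b <= M -> fin_supp u ->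
  int_value beta (carry_step a b m M u) = int_value beta u.
Proof.
move=> beta0 rel m0 bM fu.
have fq := fin_supp_sliding_block (sliding_block_carry_at b m M)
  (fun j => carry_at0 j m0 bM) fu.
have fZ c (w : int -> int) : fin_supp w -> fin_supp (fun j => c * w j).
  by apply: fin_supp_sub => j; apply: contra_neq => ->; rewrite mulr0.
have fq1 := fin_supp_shift (-1) fq.
rewrite /carry_step int_valueD ?int_valueD ?int_valueZ; try exact: fZ.
- rewrite (int_value_shift (carry_at b m M u)) // -[RHS]addr0; congr (_ + _).
  rewrite mulrA -mulrDl !rmorphN /= mulNr -opprD rel oppr0; exact: mul0r.
- exact: fu.
- by apply: fin_suppD; apply: fZ.
Qed.

(** * Reduction of wider digit ranges by iteration *)

Definition digit_reduction (F : fieldType) (beta : F) (m M k : int)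
    (G : (int -> int) -> int -> int) : Prop :=
  [/\ sliding_block G,
      forall j, G (fun=> 0) j = 0,
      forall u, (forall j, m - k <= u j <= M + k) -> forall j, m <= G u j <= M
    & forall u, fin_supp u -> int_value beta (G u) = int_value beta u].

Lemma digit_reduction_carry (F : fieldType) (beta : F) (a b m M : int) :
  beta != 0 -> a%:~R + b%:~R * beta = 0 ->
  0 < b < a -> M = m + a + b - 1 -> m <= 0 -> b <= M ->
  digit_reduction beta m M 1 (carry_step a b m M).
Proof.
move=> beta0 rel ab eM m0 bM; split.
- exact: sliding_block_carry_step.
- by move=> j; rewrite /carry_step !carry_at0 // !mulr0.
- by move=> u; apply: carry_step_digit.
- by move=> u; apply: int_value_carry_step.
Qed.

Lemma digit_reductionN (F : fieldType) (beta : F) (m M k : int) G :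
  digit_reduction beta m M k G ->
  digit_reduction beta (- M) (- m) k (fun u j => - G (fun i => - u i) j).
Proof.
have fN u : fin_supp u -> fin_supp (fun i => - u i : int).
  by apply: fin_supp_sub => i; rewrite oppr_eq0.
have valN u : int_value beta (fun i => - u i) = - int_value beta u.
  rewrite -mulN1r -(int_valueZ beta (-1)).
  by apply: eq_fsbigr => i _; rewrite mulN1r.
move=> [slG G0 Gd Gv]; split.
- apply: (sliding_block_comp (sliding_block_letter -%R)).
  exact: (sliding_block_comp slG (sliding_block_letter -%R)).
- by move=> j /=; rewrite oppr0 G0 oppr0.
- move=> u um j; have um' i : m - k <= - u i <= M + k by have := um i; lia.
  by have /andP[? ?] := Gd _ um' j; apply/andP; rewrite !lerN2.
- by move=> u fu; rewrite valN Gv ?valN ?opprK //; apply: fN.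
Qed.

Lemma digit_reduction1 (F : fieldType) (beta : F) (a b m M : int) :
  beta != 0 -> a%:~R + b%:~R * beta = 0 ->
  0 < b < a -> M = m + a + b - 1 -> m <= 0 <= M ->
  exists G, digit_reduction beta m M 1 G.
Proof.
move=> beta0 rel ab eM mM; case: (leP b M) => bM.
  exists (carry_step a b m M); apply: digit_reduction_carry => //; lia.
(* When M < b, the mirrored alphabet {-M, ..., -m} has upper end -m = a + b - 1 - M >= a > b, so the
   carry step applies to it. *)
exists (fun u j => - carry_step a b (- M) (- m) (fun i => - u i) j).
rewrite -[X in digit_reduction _ X]opprK -[X in digit_reduction _ _ X]opprK.
by apply: digit_reductionN; apply: (digit_reduction_carry beta0 rel ab); lia.
Qed.

Definition clamp (x y z : int) : int := Num.max x (Num.min y z).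

Lemma digit_reduction_iter (F : fieldType) (beta : F) (m M : int) (k : nat) :
  m <= 0 <= M -> (exists G, digit_reduction beta m M 1 G) ->
  exists G, digit_reduction beta m M k%:Z G.
Proof.
move=> mM [S [slS S0 Sd Sv]]; elim: k => [|k [G [slG G0 Gd Gv]]].
  exists id; split=> //; first by exists 0 => u v i j /(_ 0); rewrite !addr0; apply.
  by move=> u um j; have := um j; lia.
(* A digit of {m-k-1, ..., M+k+1} is one of {m-k, ..., M+k} plus -1, 0 or 1. *)
pose cl := clamp (m - k%:Z) (M + k%:Z).
have cl0 : cl 0 = 0 by rewrite /cl /clamp; lia.
pose c (u : int -> int) i := cl (u i).
pose d (u : int -> int) i := u i - cl (u i).
have slc : sliding_block c by apply: sliding_block_letter.
have sld : sliding_block d by apply: (sliding_block_letter (fun x => x - cl x)).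
have c0 : c (fun=> 0) = (fun=> 0) by apply/funext => i.
have d0 : d (fun=> 0) = (fun=> 0) by apply/funext => i; rewrite /d cl0.
have slT := sliding_block_op2 +%R (sliding_block_comp slG slc) sld.
(* [G] brings the clamped part into {m, ..., M}; adding back the excess [d] overshoots by at most
   one, which [S] absorbs. *)
exists (S \o (fun u j => G (c u) j + d u j)); split.
- exact: (sliding_block_comp slS).
- move=> j /=; rewrite -[RHS](S0 j); congr (S _ j).
  by apply/funext => i; rewrite c0 d0 G0.
- move=> u um; apply: Sd => j; have := Gd (c u) _ j.
  have : -1 <= d u j <= 1 by have := um j; rewrite /d /cl /clamp; lia.
  move=> + GP; have /GP : forall i, m - k%:Z <= c u i <= M + k%:Z.
    by move=> i; rewrite /c /cl /clamp; lia.
  lia.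
- move=> u fu /=.
  have fc : fin_supp (c u) by apply: (fin_supp_sliding_block slc) => // j; rewrite c0.
  have fd : fin_supp (d u) by apply: (fin_supp_sliding_block sld) => // j; rewrite d0.
  have fG : fin_supp (G (c u)) by apply: (fin_supp_sliding_block slG).
  rewrite Sv; last exact: fin_suppD.
  rewrite int_valueD // Gv // -int_valueD //; congr int_value.
  by apply/funext => i; rewrite /d addrC subrK.
Qed.


(** * Windows of local maps and alphabets of integers *)

Lemma p_local_window (R : realType) (A B : {fset R[i]}) p
    (phi : (int -> A) -> int -> B) : p_local p phi ->
  exists r t : nat, forall u v (j k : int),
    (forall i : int, - r%:Z <= i <= t%:Z -> u (j + i) = v (k + i)) ->
    phi u j = phi v k.
Proof.
move=> [r [t [ep [Phi PhiE]]]]; exists r, t => u v j k uv; rewrite !PhiE.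
congr Phi; apply: eq_mktuple => i; rewrite -!addrA; apply: uv.
by have := leq_trans (ltn_ord i) (eq_leq ep); lia.
Qed.

Lemma window_p_local (R : realType) (A B : {fset R[i]}) (a0 : A) (N : nat)
    (phi : (int -> A) -> int -> B) :
  (forall u v (j k : int),
    (forall i : int, `|i| <= N%:Z -> u (j + i) = v (k + i)) ->
    phi u j = phi v k) ->
  p_local (N + N + 1) phi.
Proof.
move=> phiN; exists N, N; split=> //.
(* The window lists digits from left to right, so the digit at offset i is entry N - i. The default
   [a0] is never read when |i| <= N. *)
exists (fun w => phi (fun i => nth a0 w `|(N%:Z - i)%R|%N) 0) => u j.
apply: phiN => i iN; rewrite add0r.
have lt : (`|(N%:Z - i)%R| < N + N + 1)%N by lia.
rewrite -[X in nth _ _ X]/(nat_of_ord (Ordinal lt)) nth_mktuple /=.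
by congr u; lia.
Qed.

(* Junk value 0 outside the integers. *)
Definition int_of (F : numDomainType) (x : F) : int :=
  xget 0 [set k : int | x = k%:~R]%classic.

Lemma int_ofK (F : numDomainType) (k : int) : int_of (k%:~R : F) = k.
Proof. by apply: xget_unique => // l /intr_inj. Qed.

Definition int_letters (R : realType) (A : {fset R[i]}) (m M : int) : Prop :=
  forall x : R[i], x \in A <-> exists2 k : int, m <= k <= M & x = k%:~R.

Section Digits.
Variables (R : realType) (A : {fset R[i]}) (m M : int).
Hypothesis AmM : int_letters A m M.

Lemma int_letters_mem (k : int) : ((k%:~R : R[i]) \in A) = (m <= k <= M).
Proof.
by apply/idP/idP => [/AmM[l lmM /intr_inj ->] // | kmM]; apply/AmM; exists k.
Qed.

Lemma int_letters_digit (x : A) : fsval x = (int_of (fsval x))%:~R.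
Proof.
by have /AmM[k _ xk] := fsvalP x; rewrite xk int_ofK.
Qed.

Lemma int_letters_range (x : A) : m <= int_of (fsval x) <= M.
Proof. by rewrite -int_letters_mem -int_letters_digit fsvalP. Qed.

Lemma digits_supp (u : int -> A) :
  fin_supp (fun j => int_of (fsval (u j))) <-> finitely_supported u.
Proof.
rewrite /fin_supp /finitely_supported.
suff -> : [set j | int_of (fsval (u j)) != 0]%classic =
          [set j | fsval (u j) != 0]%classic by [].
by apply/seteqP; split=> j /=; rewrite [in fsval _ != 0]int_letters_digit intr_eq0.
Qed.

Lemma digits_value beta (u : int -> A) :
  word_value beta u = int_value beta (fun j => int_of (fsval (u j))).
Proof. by apply: eq_fsbigr => j _; rewrite -int_letters_digit. Qed.

Lemma card_int_letters : m <= M -> (#|` A|)%:Z = M - m + 1.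
Proof.
move=> mM; pose n := `|(M - m + 1)%R|%N.
pose f (i : 'I_n) : R[i] := (m + i%:Z)%:~R.
have -> : A = [fset f i | i in 'I_n].
  apply/fsetP => x; apply/idP/imfsetP => /= [/AmM[k kmM ->]|[i _ ->]].
    have lt : (`|(k - m)%R| < n)%N by lia.
    by exists (Ordinal lt) => //; rewrite /f /=; congr _%:~R; lia.
  by rewrite int_letters_mem; have := ltn_ord i; rewrite /n; lia.
rewrite card_imfset /=; first by rewrite -cardE card_ord /n; lia.
by move=> i j /intr_inj/addrI [] /val_inj.
Qed.

End Digits.

Lemma int_letters_sumset (R : realType) (A : {fset R[i]}) (m M : int) :
  m <= M -> int_letters A m M -> int_letters (sumset A A) (m + m) (M + M).
Proof.
move=> mM AmM x; split.
  move=> /imfset2P[y /= /AmM[k ? ->] [z /= /AmM[l ? ->] ->]].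
  by exists (k + l); [lia | rewrite intrD].
move=> [k kmM ->]; apply/imfset2P => /=.
(* The least letter y with k - y <= M. *)
exists (Num.max m (k - M))%:~R; first by apply/AmM; eexists; last by []; lia.
exists (k - Num.max m (k - M))%:~R; first by apply/AmM; eexists; last by []; lia.
by rewrite -intrD; congr _%:~R; lia.
Qed.

(** * Digit sums modulo [a + b] *)

(** Here [g] repeats the entry of [f] at r. Cut [f] into two halves that both keep this entry, and
    move the right half by one. *)
Lemma fsum_splice (f g : int -> int) (r : int) : fin_supp f ->
  (forall j, g j = if j <= r then f j else f (j - 1)) ->
  \sum_(j \in [set: int]%classic) g j =
  \sum_(j \in [set: int]%classic) f j + f r.
Proof.
move=> ff gf.
pose f1 j := if j <= r then f j else 0.
pose f2 j := if r <= j then f j else 0.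
pose f3 j := if j == r then f j else 0.
have ff1 : fin_supp f1 by apply: fin_supp_sub ff => j; rewrite /f1; case: ifP.
have ff2 : fin_supp f2 by apply: fin_supp_sub ff => j; rewrite /f2; case: ifP.
have ff3 : fin_supp f3 by apply: fin_supp_sub ff => j; rewrite /f3; case: ifP.
transitivity (\sum_(j \in [set: int]%classic) (f1 j + f2 (j + -1))).
  apply: eq_fsbigr => j _; rewrite gf /f1 /f2.
  case: (leP j r) => jr; first by rewrite ifF ?addr0 //; lia.
  by rewrite ifT ?add0r //; lia.
rewrite fsumD //; last exact: fin_supp_shift.
rewrite fsum_shift -fsumD //.
transitivity (\sum_(j \in [set: int]%classic) (f j + f3 j)).
  apply: eq_fsbigr => j _; rewrite /f1 /f2 /f3.
  by case: (ltgtP j r); rewrite ?addr0 ?add0r.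
rewrite fsumD //; congr (_ + _).
rewrite (@fsumTE _ _ [fset r]) ?big_seq_fset1 /f3 ?eqxx // => j.
by case: ifP => [/eqP -> | _]; rewrite ?inE ?eqxx.
Qed.

Lemma dvdz_digit_sum (F : numFieldType) (a b : nat) (d : int -> int) :
  coprime a b -> (0 < b)%N -> (0 < a)%N -> fin_supp d ->
  int_value (- (a%:R / b%:R) : F) d = 0 ->
  ((a + b)%:Z %| \sum_(j \in [set: int]%classic) d j)%Z.
Proof.
move=> cab b0 a0 fd; set beta : F := - _.
have [N dN] := (fin_supp_ball d).1 fd.
have bF : (b%:R : F) != 0 by rewrite pnatr_eq0; lia.
have aF : (a%:R : F) != 0 by rewrite pnatr_eq0; lia.
have beta0 : beta != 0 by rewrite oppr_eq0 mulf_neq0 ?invr_eq0.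
pose A := fset_set [set j | d j != 0]%classic.
have memA j : (j \in A) = (d j != 0) by rewrite mem_fin_supp.
(* On the support |j| <= N, this is [beta ^ j] with denominators cleared by the common factor
   [beta ^+ N * b ^+ (N + N)]. Since -a = b modulo a + b, every [e j] is congruent to
   [b ^+ (N + N)], a unit modulo a + b. *)
pose e (j : int) : int :=
  (- a%:Z) ^+ `|(N%:Z + j)%R|%N * b%:Z ^+ `|(N%:Z - j)%R|%N.
have eE j : j \in A -> (e j)%:~R = beta ^ j * (beta ^+ N * b%:R ^+ (N + N)).
  rewrite memA => /dN jN; rewrite /e rmorphM !rmorphXn rmorphN /=.
  have -> : - a%:~R = beta * b%:R :> F by rewrite mulNr divfK.
  have -> : (N + N = `|(N%:Z + j)%R| + `|(N%:Z - j)%R|)%N by lia.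
  rewrite exprMn exprD !mulrA; congr (_ * _ * _).
  rewrite !exprnP -expfzDr //; congr (_ ^ _); lia.
rewrite /int_value (@fsumTE _ _ A); last first.
  by move=> j; rewrite memA; apply: contra_neq => ->; rewrite mul0r.
move=> /(congr1 ( *%R^~ (beta ^+ N * b%:R ^+ (N + N)))).
rewrite mul0r mulr_suml => sum0.
have {}sum0 : \sum_(j <- A) d j * e j = 0.
  apply/eqP; rewrite -(intr_eq0 F) rmorph_sum /= -[X in _ == X]sum0; apply/eqP.
  by apply: eq_big_seq => j jA; rewrite intrM eE -?mulrA.
rewrite (@fsumTE _ _ A) => [|j]; last by rewrite memA.
have eb j : j \in A -> ((a + b)%:Z %| e j - b%:Z ^+ (N + N))%Z.
  rewrite memA => /dN jN; rewrite /e.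
  have -> : (N + N = `|(N%:Z + j)%R| + `|(N%:Z - j)%R|)%N by lia.
  rewrite exprD -mulrBl dvdz_mulr // subrXX dvdz_mulr //.
  by rewrite -opprD rpredN PoszD.
have : ((a + b)%:Z %| (\sum_(j <- A) d j) * b%:Z ^+ (N + N))%Z.
  have -> : (\sum_(j <- A) d j) * b%:Z ^+ (N + N) =
            - \sum_(j <- A) d j * (e j - b%:Z ^+ (N + N)).
    under [in RHS]eq_bigr do rewrite mulrBr.
    by rewrite sumrB sum0 sub0r opprK mulr_suml.
  rewrite rpredN big_seq; apply: rpred_sum => j jA.
  by rewrite dvdz_mull // eb.
rewrite Gauss_dvdzl // coprimezXr // coprimezE /=.
by rewrite /coprime gcdnC gcdnDr gcdnC.
Qed.

Lemma parallel_addition_residue (R : realType) (A : {fset R[i]}) (m M x : int)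
    (a b : nat) :
  coprime a b -> (0 < b)%N -> (0 < a)%N -> int_letters A m M -> m <= 0 <= M ->
  allows_parallel_addition (- (a%:R / b%:R)) A -> m + m <= x <= M + M ->
  exists2 y : int, m <= y <= M & ((a + b)%:Z %| x - y)%Z.
Proof.
move=> cab b0 a0 AmM mM [p [phi [dsc /p_local_window[r [t phiW]]]]] xmM.
have BmM : int_letters (sumset A A) (m + m) (M + M).
  by apply: int_letters_sumset => //; lia.
have Bx : (x%:~R : R[i]) \in sumset A A by rewrite (int_letters_mem BmM).
have B0 : ((0 : int)%:~R : R[i]) \in sumset A A.
  by rewrite (int_letters_mem BmM); lia.
pose u (n j : int) : sumset A A := if 0 <= j < n then [` Bx] else [` B0].
pose du n j := int_of (fsval (u n j)).
pose dv n j := int_of (fsval (phi (u n) j)).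
have duE n j : du n j = if 0 <= j < n then x else 0.
  by rewrite /du /u; case: ifP => _; rewrite /= int_ofK.
have fdu n : fin_supp (du n).
  by apply/fin_supp_ball; exists `|n|%N => j; rewrite duE; case: ifP => //; lia.
have [fdv vdv] : (forall n, fin_supp (dv n)) /\
    (forall n, int_value (- (a%:R / b%:R)) (dv n) =
               int_value (- (a%:R / b%:R) : R[i]) (du n)).
  split=> n; have [fv vv] := dsc (u n) ((digits_supp BmM (u n)).1 (fdu n)).
    exact/(digits_supp AmM).
  by rewrite -(digits_value AmM) vv (digits_value BmM).
pose S (f : int -> int) := \sum_(j \in [set: int]%classic) f j.
have dvd n : ((a + b)%:Z %| S (dv n) - S (du n))%Z.
  have fN : fin_supp (fun j => -1 * du n j).
    by apply: fin_supp_sub (fdu n) => j; rewrite mulN1r oppr_eq0.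
  have -> : S (dv n) - S (du n) = S (fun j => dv n j + -1 * du n j).
    by rewrite /S fsumD // -mulr_fsumr mulN1r.
  apply: (@dvdz_digit_sum R[i]) => //; first exact: fin_suppD.
  by rewrite int_valueD // int_valueZ vdv mulN1r subrr.
(* The window length: at position r the window covers exactly {0, ..., n - 1}. *)
pose n : int := r%:Z + t%:Z + 1.
have Su : S (du (n + 1)) = S (du n) + x.
  have -> : x = du n r%:Z by rewrite duE ifT //; lia.
  apply: fsum_splice => // j; rewrite !duE /n.
  by case: (leP j r%:Z) => jr; congr (if _ then _ else _); lia.
have Sv : S (dv (n + 1)) = S (dv n) + dv n r%:Z.
  (* For j <= r the window ends before n and cannot see the added digit. For j > r it starts after 0
     and agrees with the window of [u n] at j - 1. *)
  apply: fsum_splice => // j; rewrite /dv /n.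
  case: (leP j r%:Z) => jr; congr (int_of (fsval _)); apply: phiW => i irt;
    by rewrite /u; congr (if _ then _ else _); lia.
exists (dv n r%:Z); first exact: (int_letters_range AmM).
have -> : x - dv n r%:Z =
          (S (dv n) - S (du n)) - (S (dv (n + 1)) - S (du (n + 1))).
  by rewrite Su Sv; ring.
exact: rpredB.
Qed.

(** * Conversion on alphabets with [a + b] letters, and the theorem *)

Lemma parallel_addition_card (R : realType) (A : {fset R[i]}) (m M : int)
    (a b : nat) :
  (0 < b)%N -> (b < a)%N -> int_letters A m M -> m <= 0 <= M ->
  M = m + a%:Z + b%:Z - 1 -> allows_parallel_addition (- (a%:R / b%:R)) A.
Proof.
move=> b0 ba AmM mM eM; set beta : R[i] := - _.
have bF : (b%:R : R[i]) != 0 by rewrite pnatr_eq0; lia.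
have aF : (a%:R : R[i]) != 0 by rewrite pnatr_eq0; lia.
have beta0 : beta != 0 by rewrite oppr_eq0 mulf_neq0 ?invr_eq0.
have rel : (a%:Z)%:~R + (b%:Z)%:~R * beta = 0.
  by rewrite mulrN mulrCA divff // mulr1 subrr.
(* Widening by M - m suffices: {2m, ..., 2M} lies in {2m - M, ..., 2M - m} because m <= 0 <= M. *)
have [G [[N GN] G0 Gd Gv]] : exists G, digit_reduction beta m M `|(M - m)%R|%N%:Z G.
  by apply: digit_reduction_iter => //; apply: digit_reduction1 rel _ eM mM => //; lia.
have BmM : int_letters (sumset A A) (m + m) (M + M).
  by apply: int_letters_sumset => //; lia.
have A0 : ((0 : int)%:~R : R[i]) \in A by rewrite (int_letters_mem AmM).
have B0 : ((0 : int)%:~R : R[i]) \in sumset A A.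
  by rewrite (int_letters_mem BmM); lia.
pose dig (u : int -> sumset A A) j := int_of (fsval (u j)).
(* The default letter 0 is never taken, since [G] lands in {m, ..., M}. *)
pose phi (u : int -> sumset A A) j : A := insubd [` A0] (G (dig u) j)%:~R.
have digphi u : (fun j => int_of (fsval (phi u j))) = G (dig u).
  apply/funext => j; rewrite [fsval _]insubdK ?int_ofK // /in_mem /=.
  rewrite [X in is_true X](int_letters_mem AmM); apply: Gd => i.
  by have := int_letters_range BmM (u i); rewrite -/(dig u i); lia.
exists (N + N + 1)%N, phi; split.
  move=> u /(digits_supp BmM) fu; split.
    apply/(digits_supp AmM); rewrite digphi.
    by apply: fin_supp_sliding_block => //; exists N.
  by rewrite (digits_value AmM) digphi Gv // (digits_value BmM).
apply: (window_p_local [` B0]) => u v j k uv; congr (insubd _ _%:~R).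
by apply: GN => i iN; rewrite /dig uv.
Qed.

Theorem theorem49 (R : realType) (a b : nat) (beta : R[i])
    (hab : coprime a b) (hb : (1 <= b)%N) (hba : (b < a)%N)
    (hbeta : beta = - (a%:R / b%:R)) :
  (forall A : {fset R[i]},
     contiguous_integers A -> 0 \in A -> #|` A| = (a + b)%N ->
     allows_parallel_addition beta A) /\
  (forall A : {fset R[i]},
     contiguous_integers A -> 0 \in A -> (exists2 x, x \in A & x != 0) ->
     (#|` A| < a + b)%N ->
     ~ allows_parallel_addition beta A).
Proof.
have bounds (A : {fset R[i]}) m M : int_letters A m M -> 0 \in A ->
    m <= 0 <= M /\ (#|` A|)%:Z = M - m + 1.
  move=> AmM A0; have mM : m <= 0 <= M by rewrite -(int_letters_mem AmM) mulr0z.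
  by split=> //; apply: (card_int_letters AmM); lia.
subst beta; split=> A [m [M AmM]] A0.
  move=> cA; have [mM card] := bounds _ _ _ AmM A0.
  by apply: (parallel_addition_card hb hba AmM mM); lia.
move=> [x Ax x0] cA allow; have [mM card] := bounds _ _ _ AmM A0.
have a0 : (0 < a)%N by lia.
have residue := parallel_addition_residue hab hb a0 AmM mM allow.
have small (z : int) : ((a + b)%:Z %| z)%Z -> `|z| < (a + b)%:Z -> z = 0.
  move=> dz zab; apply/eqP; rewrite -absz_eq0; apply: contraTT dz => z0.
  by rewrite dvdzE /= gtnNdvd; lia.
have [k kmM xk] := (AmM x).1 Ax.
have k0 : k != 0 by apply: contraNneq x0 => k0; rewrite xk k0.
(* If M > 0 then M + 1 <= 2M; otherwise M = 0, the nonzero letter gives m < 0, and 2m <= m - 1.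
   Either number differs from every letter by between 1 and #A < a + b, against the congruence. *)
have [M0|M0] := ltP 0 M.
  have [|y ymM /small] := residue (M + 1); first lia.
  lia.
have [|y ymM /small] := residue (m - 1); first lia.
lia.
Qed.
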